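(* Let $X$ be a Hilbert space, and let $Z\in B(X)$ be an operator of generalized index zero. Then there is a sequence of invertible operators in $B(X)$ converging (in norm) to $Z$, and $$\mathfrak{S}_\cup(Z) = \{ A\in B(X)\mid A\ker(Z)\subseteq\ker(Z) \}.$$ In particular, if $X$ is finite-dimensional and $Z$ is singular and non-zero, then for any sequence of invertible operators $U_n\to Z$ and almost all $A\in B(X)$, we have $$\|U_n A U_n^{-1}\| \to \infty \quad\text{as } n\to\infty.$$
   Context: $B(X)$ is the Banach algebra of bounded linear operators on the complex Hilbert space $X$ with the operator norm, and $B(X)^\times$ is its group of invertible elements. ''Singular'' means not invertible. ''Almost all'' is with respect to Lebesgue measure on the finite-dimensional space $B(X)$. For $A,Z\in B(X)$ put $$\mathfrak{N}_\cup(A,Z) := \limsup_{r\to 0}\ \inf_{U\in B(X)^\times,\ \|U-Z\|<r}\|UAU^{-1}\|\in\mathbb{R}\cup\{\infty\},\qquad \mathfrak{S}_\cup(Z) := \{A\in B(X)\mid \mathfrak{N}_\cup(A,Z)<\infty\}.$$ An operator $Z\in B(X)$ is of generalized index zero if there exists a continuous isomorphism $\ker(Z)\to\operatorname{coker}(Z)=X/\operatorname{im}(Z)$, i.e. a linear bijection that is a homeomorphism, where $\operatorname{coker}(Z)$ has the quotient topology; in particular, such a $Z$ has closed image. *)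

(* Defs.v *)
From HB Require Import structures.
From mathcomp Require Import all_boot all_order all_algebra.
From mathcomp Require Import sesquilinear ring_quotient generic_quotient.
From mathcomp Require Import all_classical all_reals all_analysis.
From mathcomp.real_closed Require Import complex.

Set Implicit Arguments.
Unset Strict Implicit.
Unset Printing Implicit Defensive.

Import Order.TTheory GRing.Theory Num.Theory.
Import numFieldNormedType.Exports.

Local Open Scope classical_set_scope.
Local Open Scope ring_scope.
Local Open Scope complex_scope.

Section BoundedOperators.
Context {R : realType}.
Implicit Types X Y : normedModType R[i].

(* [`|x|] is an element of [R[i]] (with zero imaginary part). *)
Definition rnorm X (x : X) : R := complex.Re `|x|.

Lemma rnormE X (x : X) : `|x| = (rnorm x)%:C.
Proof. by rewrite /rnorm RRe_real// normr_real. Qed.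

Lemma RenormE (a : R[i]) : (complex.Re `|a|)%:C = `|a|.
Proof. by rewrite RRe_real// normr_real. Qed.

Lemma Renorm_ge0 (a : R[i]) : 0 <= complex.Re `|a|.
Proof. by rewrite -lecR RenormE normr_ge0. Qed.

Lemma rnorm_ge0 X (x : X) : 0 <= rnorm x.
Proof. by rewrite -lecR -rnormE normr_ge0. Qed.

Lemma rnorm0 X : rnorm (0 : X) = 0.
Proof. by rewrite /rnorm normr0. Qed.

Lemma rnormD X (x y : X) : rnorm (x + y) <= rnorm x + rnorm y.
Proof. by rewrite -lecR rmorphD/= -!rnormE ler_normD. Qed.

Lemma rnormZ X (a : R[i]) (x : X) : rnorm (a *: x) = complex.Re `|a| * rnorm x.
Proof.
by apply: (@complexI R); rewrite rmorphM/= -!rnormE normrZ.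
Qed.

Definition bounded_op X : {pred X -> X} := fun f =>
  `[< linear f /\ exists M : R, forall x, rnorm (f x) <= M * rnorm x >].

Lemma bounded_op_submod X : submod_closed (@bounded_op X).
Proof.
split; first by apply/asboolP; split=> [a x y|];
  [rewrite scaler0 addr0|exists 0 => x; rewrite rnorm0 mul0r].
move=> a f g /asboolP[lf [M fM]] /asboolP[lg [N gN]].
apply/asboolP; split=> [b x y|].
  have -> u : (a *: f + g) u = a *: f u + g u by [].
  by rewrite lf lg !scalerDr !scalerA (mulrC b) -!addrA; congr (_ + _);
    rewrite addrCA.
exists (complex.Re `|a| * M + N) => x.
apply: (le_trans (rnormD _ _)); rewrite mulrDl lerD// rnormZ -mulrA.
by rewrite ler_wpM2l ?Renorm_ge0.
Qed.

HB.instance Definition _ X :=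
  GRing.isSubmodClosed.Build R[i] (X -> X) (@bounded_op X)
    (bounded_op_submod X).

Record bop X : Type := Bop {
  bop_fun :> X -> X ;
  bop_subproof : bop_fun \in @bounded_op X }.

HB.instance Definition _ X := [isSub for @bop_fun X].
HB.instance Definition _ X := [Choice of bop X by <:].
HB.instance Definition _ X := [SubChoice_isSubLmodule of bop X by <:].

Lemma bopP X (A : bop X) :
  linear A /\ exists M : R, forall x, rnorm (A x) <= M * rnorm x.
Proof. exact/asboolP/bop_subproof. Qed.

HB.instance Definition _ X (A : bop X) :=
  @GRing.isLinear.Build R[i] X X *:%R A (bopP A).1.

Lemma bop_eqP X (A B : bop X) : (forall x, A x = B x) -> A = B.
Proof. by move=> AB; apply/val_inj/funext. Qed.

Lemma bopD X (A B : bop X) x : (A + B) x = A x + B x. Proof. by []. Qed.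
Lemma bopZ X (a : R[i]) (A : bop X) x : (a *: A) x = a *: A x.
Proof. by []. Qed.

Definition opnorm X (A : bop X) : R :=
  sup [set rnorm (A x) | x in [set x | rnorm x <= 1]].

Lemma opnorm_has_sup X (A : bop X) :
  has_sup [set rnorm (A x) | x in [set x | rnorm x <= 1]].
Proof.
split; first by exists (rnorm (A 0)), 0 => //=; rewrite rnorm0.
have [_ [M AM]] := bopP A; exists `|M| => _ [x /= x1 <-].
rewrite (le_trans (AM x))// (le_trans (ler_wpM2r (rnorm_ge0 x) (ler_norm M)))//.
by rewrite ler_piMr.
Qed.

Lemma opnorm_unit X (A : bop X) x : rnorm x <= 1 -> rnorm (A x) <= opnorm A.
Proof.
by move=> x1; apply: ub_le_sup; [have [] := opnorm_has_sup A|exists x].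
Qed.

Lemma opnorm_ge0 X (A : bop X) : 0 <= opnorm A.
Proof.
by apply: le_trans (opnorm_unit A (x := 0) _); rewrite ?rnorm_ge0 ?rnorm0.
Qed.

Lemma opnorm_le X (A : bop X) M :
  (forall x, rnorm x <= 1 -> rnorm (A x) <= M) -> opnorm A <= M.
Proof.
move=> AM; apply: ge_sup; first by have [] := opnorm_has_sup A.
by move=> _ [x /= x1 <-]; exact: AM.
Qed.

Lemma opnormP X (A : bop X) x : rnorm (A x) <= opnorm A * rnorm x.
Proof.
have [->|x0] := eqVneq x 0; first by rewrite linear0 !rnorm0 mulr0.
have nx0 : 0 < rnorm x by rewrite -ltcR -rnormE normr_gt0.
have := @opnorm_unit X A ((rnorm x)^-1%:C *: x).
have e : complex.Re `|(rnorm x)^-1%:C| = (rnorm x)^-1.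
  by rewrite ger0_norm// lecR invr_ge0 ltW.
rewrite linearZ/= !rnormZ e mulVf ?gt_eqF// => /(_ (lexx _)).
by rewrite ler_pdivrMl// mulrC.
Qed.

Definition copnorm X (A : bop X) : R[i] := (opnorm A)%:C.

Lemma copnormD X (A B : bop X) : copnorm (A + B) <= copnorm A + copnorm B.
Proof.
rewrite /copnorm -rmorphD lecR; apply: opnorm_le => x x1; rewrite bopD.
by rewrite (le_trans (rnormD _ _))// lerD// opnorm_unit.
Qed.

Lemma copnormZ X (a : R[i]) (A : bop X) : copnorm (a *: A) = `|a| * copnorm A.
Proof.
have le_ b B : opnorm (b *: B : bop X) <= complex.Re `|b| * opnorm B.
  apply: opnorm_le => x x1.
  by rewrite bopZ rnormZ ler_wpM2l ?opnorm_unit ?Renorm_ge0.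
have -> : `|a| = (complex.Re `|a|)%:C by rewrite RenormE.
rewrite /copnorm -rmorphM; congr (_%:C); apply/eqP; rewrite eq_le le_ andTb.
have [->|a0] := eqVneq a 0; first by rewrite normr0 raddf0 mul0r opnorm_ge0.
have na0 : 0 < complex.Re `|a|.
  by rewrite -ltcR RenormE normr_gt0.
rewrite -ler_pdivlMl// -[X in opnorm X <= _](scalerK a0).
rewrite (le_trans (le_ _ _))// ler_wpM2r ?opnorm_ge0//.
rewrite -lecR RenormE normfV fmorphV/=.
by rewrite RenormE.
Qed.

Lemma copnorm0_eq0 X (A : bop X) : copnorm A = 0 -> A = 0.
Proof.
move/complexI => A0; apply: bop_eqP => x; apply/normr0_eq0.
have := opnormP A x; rewrite A0 mul0r => Ax; rewrite rnormE; congr (_%:C).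
by apply/eqP; rewrite eq_le Ax rnorm_ge0.
Qed.

(* Hence [rnorm A] is [opnorm A] for [A : bop X], and [U @ \oo --> Z] in
   [bop X] is convergence in operator norm. *)
HB.instance Definition _ X := Lmodule_isNormed.Build R[i] (bop X)
  (@copnormD X) (@copnormZ X) (@copnorm0_eq0 X).

Lemma id_bounded X : idfun \in @bounded_op X.
Proof. by apply/asboolP; split=> //; exists 1 => x; rewrite mul1r. Qed.
Definition bop_id X := Bop (id_bounded X).

Lemma comp_bounded X (A B : bop X) : (A \o B) \in @bounded_op X.
Proof.
apply/asboolP; split=> [a x y|]; first by rewrite /= !linearP.
exists (opnorm A * opnorm B) => x /=; rewrite (le_trans (opnormP A _))// -mulrA.
by rewrite ler_wpM2l ?opnorm_ge0 ?opnormP.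
Qed.
Definition bop_comp X (A B : bop X) := Bop (comp_bounded A B).

Lemma bop_compA X : associative (@bop_comp X).
Proof. by move=> A B C; exact: bop_eqP. Qed.
Lemma bop_comp1l X : left_id (@bop_id X) (@bop_comp X).
Proof. by move=> A; exact: bop_eqP. Qed.
Lemma bop_comp1r X : right_id (@bop_id X) (@bop_comp X).
Proof. by move=> A; exact: bop_eqP. Qed.
Lemma bop_compDl X : left_distributive (@bop_comp X) +%R.
Proof. by move=> A B C; exact: bop_eqP. Qed.
Lemma bop_compDr X : right_distributive (@bop_comp X) +%R.
Proof. by move=> A B C; apply: bop_eqP => x; exact: (linearD A). Qed.

(* [pzRingType], as [bop X] is the zero ring when [X] is trivial. *)
HB.instance Definition _ X := GRing.Zmodule_isPzRing.Build (bop X)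
  (@bop_compA X) (@bop_comp1l X) (@bop_comp1r X)
  (@bop_compDl X) (@bop_compDr X).

Definition bop_inverses X (U : bop X) : set (bop X) :=
  [set V | U * V = 1 /\ V * U = 1].

Definition bop_unit X : set (bop X) := [set U | bop_inverses U !=set0].

(* Meaningful on [bop_unit] only; [0] elsewhere. *)
Definition bop_inv X (U : bop X) : bop X := xget 0 (bop_inverses U).

Definition bop_ker X (Z : bop X) : set X := [set x | Z x = 0].

(* The limit superior is over [r > 0], [r] tending to [0]; the infimum of the
   empty set is [+oo]. *)
Definition Ncup X (A Z : bop X) : \bar R :=
  limf_esup (fun r : R =>
    ereal_inf [set (rnorm (U * A * bop_inv U))%:E
              | U in [set U | bop_unit U /\ rnorm (U - Z) < r]]) 0^'+.

Definition Scup X (Z : bop X) : set (bop X) := [set A | (Ncup A Z < +oo)%E].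

Definition kerp X (Z : bop X) : {pred X} := fun x => x \in bop_ker Z.

Lemma kerp_submod X (Z : bop X) : submod_closed (kerp Z).
Proof.
split=> [|a x y]; first by apply/mem_set; rewrite /bop_ker/= linear0.
move=> /set_mem Zx /set_mem Zy; apply/mem_set.
by rewrite /bop_ker/= linearP/= Zx Zy scaler0 addr0.
Qed.

HB.instance Definition _ X (Z : bop X) :=
  GRing.isSubmodClosed.Build R[i] X (kerp Z) (kerp_submod Z).

Record ker_space X (Z : bop X) : Type := KerSpace {
  ker_val :> X ;
  ker_subproof : ker_val \in kerp Z }.

HB.instance Definition _ X (Z : bop X) := [isSub for @ker_val X Z].
HB.instance Definition _ X (Z : bop X) := [Choice of ker_space Z by <:].
HB.instance Definition _ X (Z : bop X) :=
  [SubChoice_isSubLmodule of ker_space Z by <:].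
HB.instance Definition _ X (Z : bop X) :=
  Topological.copy (ker_space Z) (initial_topology (@ker_val X Z)).

Lemma ker_openE X (Z : bop X) (B : set (ker_space Z)) :
  open B = exists2 C : set X, open C & @ker_val X Z @^-1` C = B.
Proof. by []. Qed.

Definition imp X (Z : bop X) : {pred X} := fun x => x \in range Z.

Lemma imp_submod X (Z : bop X) : submod_closed (imp Z).
Proof.
split=> [|a x y]; first by apply/mem_set; exists 0 => //; rewrite linear0.
move=> /set_mem[u _ <-] /set_mem[v _ <-]; apply/mem_set.
by exists (a *: u + v) => //; rewrite linearP.
Qed.

HB.instance Definition _ X (Z : bop X) :=
  GRing.isSubmodClosed.Build R[i] X (imp Z) (imp_submod Z).

Definition coker_space X (Z : bop X) : Type := Quotient.quot (imp Z).
HB.instance Definition _ X (Z : bop X) := Choice.on (coker_space Z).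
HB.instance Definition _ X (Z : bop X) := GRing.Zmodule.on (coker_space Z).

Definition coker_pi X (Z : bop X) (x : X) : coker_space Z :=
  \pi_(Quotient.quot (imp Z))%qT x.

(* [quotient_topology] on the quotient module has another choice structure
   than the module, hence the explicit instance of the quotient topology. *)
Definition coker_open X (Z : bop X) (B : set (coker_space Z)) : Prop :=
  open (coker_pi Z @^-1` B).

Lemma coker_openT X (Z : bop X) : coker_open [set: coker_space Z].
Proof. by rewrite /coker_open preimage_setT; exact: openT. Qed.

Lemma coker_openI X (Z : bop X) : setI_closed (@coker_open X Z).
Proof. by move=> B C; exact: openI. Qed.

Lemma coker_open_bigcup X (Z : bop X) (I : Type) (B : I -> set (coker_space Z)) :
  (forall i, coker_open (B i)) -> coker_open (\bigcup_i B i).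
Proof. by move=> oB; apply: bigcup_open => i _; exact: oB. Qed.

HB.instance Definition _ X (Z : bop X) := isOpenTopological.Build
  (coker_space Z) (@coker_openT X Z) (@coker_openI X Z) (@coker_open_bigcup X Z).

Lemma coker_piE X (Z : bop X) x y :
  (coker_pi Z x == coker_pi Z y) = (x - y \in imp Z).
Proof. by rewrite -Quotient.idealrBE. Qed.

Lemma coker_piD X (Z : bop X) x y :
  coker_pi Z (x + y) = coker_pi Z x + coker_pi Z y.
Proof. exact: (Quotient.pi_add (imp Z)). Qed.

Definition coker_scale X (Z : bop X) (a : R[i]) (q : coker_space Z) :
  coker_space Z := coker_pi Z (a *: repr (q : Quotient.quot (imp Z))).

Lemma coker_scale_pi X (Z : bop X) a x :
  coker_scale a (coker_pi Z x) = coker_pi Z (a *: x).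
Proof.
apply/eqP; rewrite coker_piE -scalerBr rpredZ// -coker_piE.
by rewrite /coker_pi reprK.
Qed.

Lemma coker_piP X (Z : bop X) (q : coker_space Z) : exists x, q = coker_pi Z x.
Proof.
by exists (repr (q : Quotient.quot (imp Z))); rewrite /coker_pi reprK.
Qed.

Lemma coker_scaleA X (Z : bop X) a b (q : coker_space Z) :
  coker_scale a (coker_scale b q) = coker_scale (a * b) q.
Proof. by have [x ->] := coker_piP q; rewrite !coker_scale_pi scalerA. Qed.

Lemma coker_scale1 X (Z : bop X) : left_id 1 (@coker_scale X Z).
Proof.
by move=> q; have [x ->] := coker_piP q; rewrite coker_scale_pi scale1r.
Qed.

Lemma coker_scaleDr X (Z : bop X) : right_distributive (@coker_scale X Z) +%R.
Proof.
move=> a p q; have [x ->] := coker_piP p; have [y ->] := coker_piP q.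
by rewrite -coker_piD !coker_scale_pi scalerDr coker_piD.
Qed.

Lemma coker_scaleDl X (Z : bop X) (q : coker_space Z) :
  {morph (@coker_scale X Z)^~ q : a b / a + b}.
Proof.
move=> a b; have [x ->] := coker_piP q.
by rewrite !coker_scale_pi scalerDl coker_piD.
Qed.

HB.instance Definition _ X (Z : bop X) :=
  GRing.Zmodule_isLmodule.Build R[i] (coker_space Z)
    (@coker_scaleA X Z) (@coker_scale1 X Z)
    (@coker_scaleDr X Z) (@coker_scaleDl X Z).

Definition generalized_index_zero X (Z : bop X) : Prop :=
  exists (f : {linear ker_space Z -> coker_space Z})
         (g : coker_space Z -> ker_space Z),
    [/\ cancel f g, cancel g f, continuous f & continuous g].

Definition finite_dimensional X : Prop :=
  exists (n : nat) (e : 'I_n -> X),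
    forall x, exists a : 'I_n -> R[i], x = \sum_(i < n) a i *: e i.

End BoundedOperators.

(* The library puts a sigma-finite measure structure on [m1 \x m2] for
   subprobabilities only, which shadows the general one. *)
Section LebesgueProduct.
Local Open Scope ereal_scope.
Context {R : realType} {d : measure_display} {T : measurableType d}.
Variable m : {sigma_finite_measure set T -> \bar R}.

Definition lebesgue_prod : set (measurableTypeR R * T) -> \bar R :=
  @lebesgue_measure R \x m.

HB.instance Definition _ := Measure.on lebesgue_prod.

Let lebesgue_prod_sigma_finite : sigma_finite setT lebesgue_prod.
Proof.
have /sigma_finiteP[F [TF ndF Foo]] := sigma_finiteT (@lebesgue_measure R).
have /sigma_finiteP[G [TG ndG Goo]] := sigma_finiteT m.
exists (fun n => F n `*` G n).
  rewrite -setXTT TF TG predeqE => -[x y]; split.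
    move=> [/= [n _ Fnx] [k _ Gky]]; exists (maxn n k) => //; split.
    - by move: x Fnx; exact/subsetPset/ndF/leq_maxl.
    - by move: y Gky; exact/subsetPset/ndG/leq_maxr.
  by move=> [n _ []/= ? ?]; split; exists n.
move=> k; have [? ?] := Foo k; have [? ?] := Goo k.
split; first exact: measurableX.
by rewrite /lebesgue_prod product_measure1E// lte_mul_pinfty// ge0_fin_numE.
Qed.

HB.instance Definition _ :=
  Measure_isSigmaFinite.Build _ _ _ lebesgue_prod lebesgue_prod_sigma_finite.

End LebesgueProduct.

Record sfspace (R : realType) := SFSpace {
  sf_display : measure_display ;
  sf_type : measurableType sf_display ;
  sf_measure : {sigma_finite_measure set sf_type -> \bar R} }.

(* R^d with the d-fold product of the Lebesgue measure of R. *)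
Fixpoint lebesgue_space (R : realType) (d : nat) : sfspace R :=
  match d with
  | 0 => SFSpace (dirac tt : {sigma_finite_measure set unit -> \bar R})
  | d'.+1 => SFSpace (lebesgue_prod (sf_measure (lebesgue_space R d'))
      : {sigma_finite_measure set _ -> \bar R})
  end.

Fixpoint coords (R : realType) (d : nat) :
    sf_type (lebesgue_space R d) -> seq R :=
  match d with
  | 0 => fun=> [::]
  | d'.+1 => fun c => c.1 :: coords c.2
  end.

(* A basis of [V] as a vector space over the reals. *)
Definition real_basis (R : realType) (V : lmodType R[i]) d (b : 'I_d -> V) :=
  forall v, exists! c : 'rV[R]_d, v = \sum_(i < d) (c 0 i)%:C *: b i.

(* Lebesgue measure on a finite-dimensional [V] is the image of that of R^d
   under the coordinates in a real basis. A change of basis multiplies it by a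
   positive constant, so its null sets depend on no choice of basis. *)
Definition lebesgue_ae (R : realType) (V : lmodType R[i]) (P : set V) : Prop :=
  forall d (b : 'I_d -> V), real_basis b ->
    {ae sf_measure (lebesgue_space R d),
      forall c : sf_type (lebesgue_space R d),
        P (\sum_(i < d) ((coords c)`_i)%:C *: b i)}.

(* Main.v *)
(* The kernel and the image of [Z] are closed, so [X] splits orthogonally along
   both. The given isomorphism of [ker Z] with [coker Z], that is, with the
   orthogonal complement of [im Z], extends by zero to an operator [W] such that
   [Z + W] is bijective, hence invertible. With [P] the projection onto [ker Z]
   and [D_a = 1 - P + a P], the operators [Z + a W = (Z + W) D_a] are invertible
   for [a > 0] and tend to [Z] as [a] tends to [0]. If [A] preserves [ker Z],
   the only unbounded term [a^-1 (1 - P) A P] of [D_a A D_a^-1] vanishes.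
   Conversely, [U A k = (U A U^-1) (U k)] and [U k] tends to [Z k = 0] for [k]
   in [ker Z], so a bound on the norms of [U A U^-1] forces [Z A k = 0]; otherwise
   these norms tend to infinity. In finite dimension, the operators [A] with
   [Z A k = 0] for a fixed non-zero [k] in [ker Z] lie in a real hyperplane. *)
Require Import Defs.
From mathcomp Require Import all_boot all_order all_algebra.
From mathcomp Require Import sesquilinear.
From mathcomp Require Import all_classical all_reals all_analysis.
From mathcomp.real_closed Require Import complex.
From mathcomp Require Import measurable_realfun ring lra.

Set Implicit Arguments.
Unset Strict Implicit.
Unset Printing Implicit Defensive.

Import Order.TTheory GRing.Theory Num.Theory.
Import numFieldNormedType.Exports.

Local Open Scope classical_set_scope.
Local Open Scope ring_scope.
Local Open Scope complex_scope.

(** * The real-valued norm and the topology it induces *)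

Section RealNorm.
Context {R : realType}.
Implicit Type X : normedModType R[i].

Lemma rnormN X (x : X) : rnorm (- x) = rnorm x.
Proof. by rewrite /rnorm normrN. Qed.

Lemma rnorm_distC X (x y : X) : rnorm (x - y) = rnorm (y - x).
Proof. by rewrite /rnorm distrC. Qed.

Lemma rnormB X (x y : X) : rnorm (x - y) <= rnorm x + rnorm y.
Proof. by rewrite (le_trans (rnormD _ _))// rnormN. Qed.

Lemma rnorm_eq0 X (x : X) : (rnorm x == 0) = (x == 0).
Proof.
by apply/eqP/eqP => [x0|->]; [apply/normr0_eq0; rewrite rnormE x0|exact: rnorm0].
Qed.

Lemma rnorm_gt0 X (x : X) : (0 < rnorm x) = (x != 0).
Proof. by rewrite lt_neqAle rnorm_ge0 andbT eq_sym rnorm_eq0. Qed.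

Lemma rnormZR X (a : R) (x : X) : rnorm (a%:C *: x) = `|a| * rnorm x.
Proof.
rewrite rnormZ; congr (_ * _).
by rewrite normc_def /= expr0n/= addr0 sqrtr_sqr.
Qed.

Lemma rnorm_triangle X (y x z : X) : rnorm (x - z) <= rnorm (x - y) + rnorm (y - z).
Proof. by rewrite (le_trans _ (rnormD _ _))// addrA subrK. Qed.


Lemma nbhs_rnormP X (x : X) (B : set X) :
  nbhs x B <-> exists2 e : R, 0 < e & forall y, rnorm (x - y) < e -> B y.
Proof.
split=> [/nbhs_ballP[e /= e0 eB]|[e e0 eB]].
  have eE : e = (complex.Re e)%:C by rewrite RRe_real// gtr0_real.
  exists (complex.Re e); first by rewrite -ltcR -eE.
  by move=> y xy; apply: eB; rewrite -ball_normE/= eE rnormE ltcR.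
apply/nbhs_ballP; exists e%:C; first by rewrite /= ltcR.
by move=> y; rewrite -ball_normE/= rnormE ltcR; exact: eB.
Qed.

Lemma cvg_rnormP X (u : nat -> X) (l : X) :
  u @ \oo --> l <->
  forall e : R, 0 < e -> \forall n \near \oo, rnorm (l - u n) < e.
Proof.
split=> [ul e e0|ul B /nbhs_rnormP[e e0 eB]].
  have /ul : nbhs l [set y | rnorm (l - y) < e] by apply/nbhs_rnormP; exists e.
  by [].
by rewrite nbhs_simpl; near=> n; apply: eB; near: n; exact: ul.
Unshelve. all: by end_near. Qed.

End RealNorm.

(** * Two consequences of completeness *)

Section Completeness.
Context {R : realType} {X : completeNormedModType R[i]}.

(** The step bounds telescope, so [y] is Cauchy with explicit rate [r], which survives in the limit.
    The rate is what the later iterations use. *)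
Lemma shrinking_cvg (y : nat -> X) (r : nat -> R) :
  (forall n, rnorm (y n.+1 - y n) <= r n - r n.+1) -> r @ \oo --> 0 ->
  exists l, forall n, rnorm (l - y n) <= r n.
Proof.
move=> yr r0.
have dist n m : rnorm (y (n + m)%N - y n) <= r n - r (n + m)%N.
  elim: m => [|m IH]; first by rewrite addn0 !subrr rnorm0.
  rewrite addnS (le_trans (rnorm_triangle (y (n + m)%N) _ _))//.
  by have := yr (n + m)%N; lra.
have ndec : nonincreasing_seq r.
  apply/nonincreasing_seqP => n.
  by have := yr n; have := rnorm_ge0 (y n.+1 - y n); lra.
have r_ge0 n : 0 <= r n.
  rewrite -(cvg_lim (@Rhausdorff R) r0).
  by apply: nonincreasing_cvgn_ge => //; apply/cvg_ex; exists 0.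
have /cvg_ex[l /cvg_rnormP yl] : cvg (y @ \oo).
  apply: cauchy_cvg; apply: cauchy_exP => e e0; rewrite /fmapE.
  have eE : e = (complex.Re e)%:C by rewrite RRe_real// gtr0_real.
  have {}e0 : 0 < complex.Re e by rewrite -ltcR -eE.
  have /cvgrPdist_lt/(_ _ e0)[N _ rN] := r0.
  exists (y N), N => // m Nm /=; rewrite -ball_normE/= eE rnormE ltcR rnorm_distC.
  have := dist N (m - N)%N; rewrite subnKC// => /le_lt_trans; apply.
  have := rN N (leqnn _); rewrite sub0r normrN ger0_norm//.
  by have := r_ge0 m; lra.
exists l => n; apply/ler_addgt0Pl => e e0.
near \oo => m.
have nm : (n <= m)%N by near: m; exists n.
have lm : rnorm (l - y m) < e by near: m; exact: yl.
have := dist n (m - n)%N; rewrite subnKC// => dnm.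
by have := rnorm_triangle (y m) l (y n); have := r_ge0 m; lra.
Unshelve. all: by end_near. Qed.

(* Baire's theorem, which the library has over real scalars only. *)
Lemma nonmeager (C : nat -> set X) :
  (forall n x, ~ C n x ->
    exists2 e : R, 0 < e & forall y, rnorm (y - x) < e -> ~ C n y) ->
  (forall x, exists n, C n x) ->
  exists n x (e : R), 0 < e /\ forall y, rnorm (y - x) < e -> C n y.
Proof.
move=> Ccl Ccov; apply: contrapT => nC.
have step (a : nat * (X * {posnum R})) : exists b : X * {posnum R},
    [/\ b.2%:num <= a.2.2%:num / 2,
        rnorm (b.1 - a.2.1) <= a.2.2%:num - b.2%:num &
        forall w, rnorm (w - b.1) <= b.2%:num -> ~ C a.1 w].
  case: a => n [x r] /=.
  have [z [zr nCz]] : exists z, rnorm (z - x) < r%:num /\ ~ C n z.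
    apply: contrapT => nz; apply: nC; exists n, x, r%:num; split => // y yx.
    by apply: contrapT => nCy; apply: nz; exists y.
  have [e e0 eC] := Ccl _ _ nCz.
  (* The three terms halve the radius, keep the new ball inside the old one and, as [e / 2 < e],
     make even the closed new ball miss [C n]. *)
  have m0 : 0 < Num.min (r%:num / 2) (Num.min (r%:num - rnorm (z - x)) (e / 2)).
    by rewrite !lt_min !divr_gt0//= subr_gt0 zr.
  exists (z, PosNum m0) => /=; split.
  - by rewrite ge_min lexx.
  - by rewrite lerBrDr -lerBrDl !ge_min lexx !orbT.
  - move=> w wz; apply: eC; apply: le_lt_trans wz _.
    by rewrite !gt_min; apply/orP; right; apply/orP; right; lra.
have [f fP] := choice step.
pose ar := fix ar n := if n is p.+1 then f (p, ar p) else (0 : X, PosNum (@ltr01 R)).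
have [|| l lP] := @shrinking_cvg (fun n => (ar n).1) (fun n => (ar n).2%:num).
- by move=> n; have [_] := fP (n, ar n).
- have ar2 n : (ar n).2%:num <= (2^-1) ^+ n.
    elim: n => [|n IH] //=.
    by have [/le_trans + _ _] := fP (n, ar n); apply; rewrite exprSr ler_pM2r.
  apply/cvgrPdist_lt => e e0.
  have h1 : `|2^-1 : R| < 1 by rewrite ger0_norm ?invr_ge0// invf_lt1// ltr1n.
  have /cvgrPdist_lt/(_ _ e0)[N _ NP] := cvg_expr h1.
  exists N => // n /NP; apply: le_lt_trans.
  rewrite !sub0r !normrN ger0_norm// (le_trans (ar2 n))//.
  by rewrite ger0_norm ?exprn_ge0 ?invr_ge0.
(* The limit lies in all the closed balls; the one of index [n.+1] misses [C n]. *)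
have [n Cn] := Ccov l.
have [_ _ /(_ l)] := fP (n, ar n); apply => //.
exact: lP n.+1.
Qed.

End Completeness.

(** * The bounded inverse theorem *)

Section BoundedInverse.
Context {R : realType}.

Lemma cvg_geometric2 (c : R) : (fun n => c * 2^-1 ^+ n) @ \oo --> 0.
Proof.
by apply: cvg_geometric; rewrite ger0_norm ?invr_ge0// invf_lt1// ltr1n.
Qed.

Lemma le_geometric2 (a c : R) : (forall n, a <= c * 2^-1 ^+ n) -> a <= 0.
Proof.
move=> ac; rewrite -(cvg_lim (@Rhausdorff R) (cvg_geometric2 c)).
apply: limr_ge; first by apply/cvg_ex; exists 0; exact: cvg_geometric2.
exact: nearW.
Qed.

Lemma bop_ex (X : normedModType R[i]) (f : X -> X) (M : R) :
  linear f -> (forall x, rnorm (f x) <= M * rnorm x) ->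
  exists A : bop X, forall x, A x = f x.
Proof.
move=> lf fM; have bf : f \in @bounded_op R X by apply/asboolP; split; last exists M.
by exists (Bop bf).
Qed.

Lemma bop_invE (X : normedModType R[i]) (U V : bop X) :
  U * V = 1 -> V * U = 1 -> bop_inv U = V.
Proof.
move=> UV VU; rewrite /bop_inv; case: xgetP => [W _ [UW WU]|nW].
  by rewrite -[W]mul1r -VU -mulrA UW mulr1.
by case: (nW V).
Qed.

Lemma bop_invP (X : normedModType R[i]) (U : bop X) :
  bop_unit U -> U * bop_inv U = 1 /\ bop_inv U * U = 1.
Proof. by case=> V [UV VU]; rewrite (bop_invE UV VU). Qed.

Context {X : completeNormedModType R[i]}.

(** By Baire, the closure of the image of some ball contains a ball. Hence every [z] has an
    approximate preimage, of norm at most [K * rnorm z], with error at most half of [rnorm z].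
    Iterating on the errors and summing the corrections gives an exact preimage of controlled
    norm. *)
Lemma bounded_inverse (T : bop X) :
  injective T -> (forall y, exists x, T x = y) -> bop_unit T.
Proof.
move=> Tinj Tsurj.
(* The closure of the image of the closed ball of radius [n]. *)
pose C n := [set y : X | forall d : R, 0 < d ->
  exists2 x, rnorm x <= n%:R & rnorm (y - T x) < d].
have [||n [y0 [e [e0 Ce]]]] := @nonmeager R X C.
- move=> n x nCx; apply: contrapT => nE; apply: nCx => d d0.
  apply: contrapT => nd; apply: nE; exists (d / 2); first lra.
  move=> y yx Cny; apply: nd.
  have [|u un yu] := Cny (d / 2); first lra.
  exists u => //; have := rnorm_triangle y x (T u).
  by rewrite (rnorm_distC x y); lra.
- move=> y; have [x <-] := Tsurj y.
  exists (Num.truncn (rnorm x)).+1 => d d0; exists x; last by rewrite subrr rnorm0.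
  by rewrite ltW// truncnS_gt.
(* Subtracting approximate preimages of [y0 + z] and [y0] recentres the ball at 0 and doubles the
   radius [n]. *)
have approx z d : rnorm z < e -> 0 < d ->
    exists2 x, rnorm x <= 2 * n%:R & rnorm (z - T x) < d.
  move=> ze d0; have d2 : 0 < d / 2 by lra.
  have [|x1 x1n x1d] := Ce (y0 + z) _ _ d2; first by rewrite addrAC subrr add0r.
  have [|x2 x2n x2d] := Ce y0 _ _ d2; first by rewrite subrr rnorm0.
  exists (x1 - x2); first by rewrite (le_trans (rnormB _ _))//; lra.
  have -> : z - T (x1 - x2) = (y0 + z - T x1) - (y0 - T x2).
    rewrite linearB/= opprB [y0 + z]addrC -addrA opprB [T x2 - y0]addrC addrACA.
    by rewrite addNKr addrA addrAC.
  by rewrite (le_lt_trans (rnormB _ _))//; lra.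
(* Scaled to norm [e / 2] and approximated up to [e / 4], a vector keeps half its norm as error;
   undoing the scaling turns [2 * n] into [K * rnorm z]. *)
pose K := 4 * n%:R / e.
have K0 : 0 <= K by rewrite divr_ge0 ?mulr_ge0// ltW.
have halving z : exists x, rnorm x <= K * rnorm z /\ rnorm (z - T x) <= rnorm z / 2.
  have [->|] := eqVneq z 0.
    by exists 0; rewrite linear0 subrr rnorm0 mulr0 mul0r.
  rewrite -rnorm_gt0 => z0.
  pose c := e / 2 / rnorm z.
  have c0 : 0 < c by rewrite !divr_gt0.
  have [||x xn xd] := approx (c%:C *: z) (e / 4); [|lra|].
    by rewrite rnormZR gtr0_norm// divfK ?gt_eqF//; lra.
  exists (c^-1%:C *: x); rewrite rnormZR gtr0_norm ?invr_gt0//; split.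
    rewrite ler_pdivrMl// (le_trans xn)// /K /c.
    suff -> : e / 2 / rnorm z * (4 * n%:R / e * rnorm z) = 2 * n%:R by [].
    by field; rewrite !gt_eqF.
  have -> : z - T (c^-1%:C *: x) = c^-1%:C *: (c%:C *: z - T x).
    rewrite scalerBr scalerA -rmorphM mulVf ?gt_eqF// scale1r linearZ//.
  rewrite rnormZR gtr0_norm ?invr_gt0// ler_pdivrMl// (le_trans (ltW xd))// /c.
  suff -> : e / 2 / rnorm z * (rnorm z / 2) = e / 4 by [].
  by field; rewrite gt_eqF.
have [h hP] := choice halving.
have solve z : exists x, T x = z /\ rnorm x <= 2 * K * rnorm z.
  (* [zs] holds the remaining errors and [xs] the partial sums of corrections. *)
  pose zs := fix zs n := if n is p.+1 then zs p - T (h (zs p)) else z.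
  pose xs := fix xs n := if n is p.+1 then xs p + h (zs p) else 0.
  have zsle k : rnorm (zs k) <= rnorm z * 2^-1 ^+ k.
    elim: k => [|k IH]; first by rewrite expr0 mulr1.
    have [_ /le_trans] := hP (zs k); rewrite exprSr mulrA; apply.
    by rewrite ler_pM2r.
  have Txs k : T (xs k) = z - zs k.
    elim: k => [|k IH]; first by rewrite linear0 subrr.
    by rewrite linearD/= IH opprB addrC addrCA addrC.
  have [||l lP] := @shrinking_cvg R X xs (fun k => 2 * K * rnorm z * 2^-1 ^+ k).
  - move=> k /=; rewrite addrAC subrr add0r.
    have [/le_trans + _] := hP (zs k); apply.
    rewrite (le_trans (ler_wpM2l K0 (zsle k)))// exprS.
    by rewrite le_eqVlt; apply/orP; left; apply/eqP; field.
  - exact: cvg_geometric2.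
  exists l; split; last by have := lP 0%N; rewrite subr0 expr0 mulr1.
  apply/eqP; rewrite -subr_eq0 -rnorm_eq0 eq_le rnorm_ge0 andbT.
  apply: (@le_geometric2 _ (opnorm T * (2 * K * rnorm z) + rnorm z)) => k.
  rewrite (le_trans (rnorm_triangle (T (xs k)) _ _))// mulrDl lerD//.
    rewrite -linearB (le_trans (opnormP _ _))// -mulrA.
    by rewrite ler_wpM2l ?opnorm_ge0//; exact: lP.
  by rewrite Txs addrAC subrr add0r rnormN.
have [g gP] := choice solve.
have [|y|S SE] := @bop_ex X g (2 * K); last 1 first.
- exists S; split; apply: bop_eqP => x /=; first by rewrite SE (gP x).1.
  by rewrite SE; apply: Tinj; rewrite (gP (T x)).1.
- by move=> a x y; apply: Tinj; rewrite linearP (gP (a *: x + y)).1 /= (gP x).1 (gP y).1.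
- exact: (gP y).2.
Qed.

End BoundedInverse.

(** * Hilbert space geometry up to orthogonal projections *)

Section InnerProduct.
Context {R : realType} {X : completeNormedModType R[i]}.
Variable dotp : {dot X for @Num.conj R[i]}.
Hypothesis dotp_norm : forall x : X, `|x| ^+ 2 = dotp x x.

Lemma dotpE (x : X) : dotp x x = (rnorm x ^+ 2)%:C.
Proof. by rewrite -dotp_norm rnormE rmorphXn. Qed.

Lemma parallelogram (x y : X) :
  rnorm (x + y) ^+ 2 + rnorm (x - y) ^+ 2 =
  2 * rnorm x ^+ 2 + 2 * rnorm y ^+ 2.
Proof.
rewrite -mulrDr mulr2n mulrDl mul1r; apply: (@complexI R).
rewrite !rmorphD/= -!dotpE dnormD dnormB.
by rewrite addrACA subrr addr0.
Qed.

Lemma pythagoras (x y : X) :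
  dotp x y = 0 -> rnorm (x + y) ^+ 2 = rnorm x ^+ 2 + rnorm y ^+ 2.
Proof.
move=> xy; apply: (@complexI R); rewrite rmorphD/= -!dotpE dnormD xy.
by rewrite conjC0 !addr0.
Qed.

Lemma pythagoras_le (x p : X) :
  dotp (x - p) p = 0 -> rnorm p <= rnorm x /\ rnorm (x - p) <= rnorm x.
Proof.
move=> /pythagoras; rewrite subrK => xE; split;
  by rewrite -ler_sqr ?nnegrE ?rnorm_ge0// xE ?lerDl ?lerDr sqr_ge0.
Qed.

Lemma orthogonal_part (x y : X) : y != 0 ->
  dotp (x - (dotp x y / dotp y y) *: y) y = 0.
Proof.
move=> y0; rewrite linearBl/= linearZl_LR/= divfK ?subrr//.
by rewrite gt_eqF// neq0_dnorm_gt0.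
Qed.

Lemma rnorm_orthogonal_part (x y : X) : y != 0 ->
  rnorm x ^+ 2 = rnorm (x - (dotp x y / dotp y y) *: y) ^+ 2 +
                 rnorm ((dotp x y / dotp y y) *: y) ^+ 2.
Proof.
move=> y0; rewrite -pythagoras ?subrK//.
by rewrite linearZr_LR/= orthogonal_part// mulr0.
Qed.

(** By Pythagoras the component [t *: y] of [x] along [y] is no longer than [x]. *)
Lemma cauchy_schwarz (x y : X) : complex.Re `|dotp x y| <= rnorm x * rnorm y.
Proof.
have [->|y0] := eqVneq y 0.
  by rewrite linear0r normr0 rnorm0 mulr0.
have y_gt0 : 0 < rnorm y by rewrite rnorm_gt0.
have := rnorm_orthogonal_part x y0.
set t := _ / _ => xE.
have tx : rnorm (t *: y) <= rnorm x.
  rewrite -ler_sqr ?nnegrE ?rnorm_ge0// xE.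
  by rewrite lerDr sqr_ge0.
have -> : dotp x y = t * (rnorm y ^+ 2)%:C.
  by rewrite /t -dotpE divfK// gt_eqF// neq0_dnorm_gt0.
rewrite normrM [`|_%:C|]ger0_norm ?lecR ?sqr_ge0// -(RenormE t) -rmorphM.
rewrite [complex.Re _]/= expr2 mulrA ler_pM2r//.
by rewrite rnormZ in tx.
Qed.

(** Removing the component of [x] along [y] would shorten [x] unless that component is zero. *)
Lemma orthogonal_of_nearest (x y : X) :
  (forall t, rnorm x <= rnorm (x - t *: y)) -> dotp x y = 0.
Proof.
move=> xmin; have [->|y0] := eqVneq y 0; first by rewrite linear0r.
have := rnorm_orthogonal_part x y0.
set t := _ / _ => xE.
have : rnorm (t *: y) ^+ 2 <= 0.
  have : rnorm x ^+ 2 <= rnorm (x - t *: y) ^+ 2.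
    by rewrite ler_sqr ?nnegrE ?rnorm_ge0.
  by lra.
rewrite le_eqVlt ltNge sqr_ge0 orbF sqrf_eq0 rnorm_eq0 scaler_eq0 (negbTE y0) orbF.
by rewrite mulf_eq0 invr_eq0 [dotp y y == 0]gt_eqF ?neq0_dnorm_gt0// orbF => /eqP.
Qed.

Section Projection.
Variable M : set X.
Hypothesis M0 : M 0.
Hypothesis MP : forall a x y, M x -> M y -> M (a *: x + y).
Hypothesis Mcl : forall x,
  (forall e : R, 0 < e -> exists2 m, M m & rnorm (x - m) < e) -> M x.

(** Midpoints of a minimizing sequence stay in [M], so the parallelogram law bounds the distance of
    two terms by their excess over the infimum. *)
Lemma nearest_point (x : X) :
  exists2 p, M p & forall m, M m -> rnorm (x - p) <= rnorm (x - m).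
Proof.
pose E := [set rnorm (x - m) ^+ 2 | m in M].
have Ei : has_inf E.
  split; first by exists (rnorm (x - 0) ^+ 2), 0.
  by exists 0 => _ [m _ <-]; exact: sqr_ge0.
have infE m : M m -> inf E <= rnorm (x - m) ^+ 2.
  by move=> Mm; apply: ge_inf; [case: Ei|exists m].
have q0 n : 0 < (2^-1 : R) ^+ n by rewrite exprn_gt0 ?invr_gt0.
(* With excess below the square of [q = 2^-1 ^+ n], the parallelogram law bounds the squared step by
   [5/2 * q ^+ 2], below the square of [2 * q], the decrease of the rate [4 * 2^-1 ^+ n]. *)
have /choice[m mP] : forall n, exists m, M m /\
    rnorm (x - m) ^+ 2 < inf E + (2^-1 ^+ n) ^+ 2.
  move=> n; have [_ [m Mm <-] mE] := inf_adherent (exprn_gt0 2 (q0 n)) Ei.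
  by exists m.
have [||l lP] := @shrinking_cvg R X m (fun n => 4 * 2^-1 ^+ n).
- move=> n; rewrite exprS; set q := 2^-1 ^+ n.
  have -> : 4 * q - 4 * (2^-1 * q) = 2 * q by field.
  rewrite -ler_sqr ?nnegrE ?rnorm_ge0 ?mulr_ge0 ?(ltW (q0 n))//.
  pose mid := (2^-1 : R)%:C *: m n + ((2^-1 : R)%:C *: m n.+1 + 0).
  have Mmid : M mid by apply: MP; [exact: (mP n).1|apply: MP => //; exact: (mP _).1].
  have := parallelogram (x - m n) (x - m n.+1).
  have -> : x - m n - (x - m n.+1) = m n.+1 - m n by rewrite opprB addrC addrA subrK.
  have -> : x - m n + (x - m n.+1) = 2%:C *: (x - mid).
    rewrite /mid addr0 -scalerDr scalerBr scalerA -rmorphM mulfV// scale1r.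
    by rewrite rmorphMn/= rmorph1 scaler_nat mulr2n addrACA -opprD.
  rewrite rnormZR ger0_norm// exprMn.
  have := infE _ Mmid; have := (mP n).2; have := (mP n.+1).2.
  rewrite [2^-1 ^+ n.+1]exprS -/q.
  by rewrite !exprMn; have := sqr_ge0 q; lra.
- exact: cvg_geometric2.
have Ml : M l.
  apply: Mcl => e e0; have /cvgrPdist_lt/(_ _ e0)[N _ NP] := @cvg_geometric2 R 4.
  exists (m N); first exact: (mP N).1.
  apply: le_lt_trans (lP N) _; have := NP N (leqnn N).
  by rewrite sub0r normrN ger0_norm// mulr_ge0// ltW.
exists l => // p Mp; rewrite -subr_le0.
(* 5 = 1 + 4: [m n] is optimal up to [2^-1 ^+ n] and within [4 * 2^-1 ^+ n] of [l]. *)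
apply: (@le_geometric2 _ _ 5) => n.
have h : rnorm (x - m n) <= rnorm (x - p) + 2^-1 ^+ n.
  rewrite -ler_sqr ?nnegrE ?addr_ge0 ?rnorm_ge0 ?(ltW (q0 n))// sqrrD.
  have := infE _ Mp; have := (mP n).2.
  have := mulr_ge0 (rnorm_ge0 (x - p)) (ltW (q0 n)); rewrite mulr2n; lra.
have := rnorm_triangle (m n) x l; rewrite (rnorm_distC (m n) l).
by have := lP n; lra.
Qed.

(** Nearest points are characterized by orthogonality, a linear condition, which makes them unique
    and linear in [x]; Pythagoras gives the bound 1. *)
Lemma projection : exists P : bop X,
  (forall x, M (P x)) /\ forall x m, M m -> dotp (x - P x) m = 0.
Proof.
have near x : exists p, M p /\ forall m, M m -> dotp (x - p) m = 0.
  have [p Mp pmin] := nearest_point x; exists p; split=> // m Mm.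
  apply: orthogonal_of_nearest => t; rewrite -addrA -opprD; apply: pmin.
  by rewrite addrC; exact: MP.
have [P PP] := choice near.
have uniq x p : M p -> (forall m, M m -> dotp (x - p) m = 0) -> P x = p.
  move=> Mp px; have [MPx Px] := PP x.
  have Md : M (P x - p) by rewrite addrC -scaleN1r; apply: MP.
  apply/eqP; rewrite -subr_eq0 -rnorm_eq0 -sqrf_eq0; apply/eqP.
  apply: (@complexI R); rewrite -dotpE.
  have {1}-> : P x - p = (x - p) - (x - P x) by rewrite opprB [RHS]addrC addrA subrK.
  by rewrite linearBl/= px// Px// subrr.
have [| |Q QE] := @bop_ex R X P 1.
- move=> a x y; apply: uniq; first by apply: MP; exact: (PP _).1.
  move=> m Mm; rewrite opprD addrACA -scalerBr linearDl/= linearZl_LR/=.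
  by rewrite !(PP _).2// mulr0 addr0.
- move=> x; rewrite mul1r; apply: (pythagoras_le _).1.
  by apply: (PP x).2; exact: (PP x).1.
- by exists Q; split=> [x|x m Mm]; rewrite QE; [exact: (PP x).1|exact: (PP x).2].
Qed.

End Projection.
End InnerProduct.

(** * Generalized index zero: closed image and an invertible perturbation *)

Section IndexZero.
Context {R : realType} {X : completeNormedModType R[i]}.
Variable dotp : {dot X for @Num.conj R[i]}.
Hypothesis dotp_norm : forall x : X, `|x| ^+ 2 = dotp x x.

Lemma coker_pi_eq0 (Z : bop X) x : coker_pi Z x = 0 <-> range Z x.
Proof.
have -> : (0 : coker_space Z) = coker_pi Z 0.
  by apply: (addIr (coker_pi Z 0)); rewrite add0r -coker_piD addr0.
split=> [/eqP|Zx]; first by rewrite coker_piE subr0 => /set_mem.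
by apply/eqP; rewrite coker_piE subr0; exact/mem_set.
Qed.

Lemma coker_pi_linear (Z : bop X) a x y :
  coker_pi Z (a *: x + y) = a *: coker_pi Z x + coker_pi Z y.
Proof. by rewrite coker_piD -coker_scale_pi. Qed.

Lemma bounded_of_ball (W : X -> X) (d : R) : 0 < d -> linear W ->
  (forall x, rnorm x < d -> rnorm (W x) <= 1) ->
  forall x, rnorm (W x) <= 2 / d * rnorm x.
Proof.
move=> d0 lW W1 x.
have WZ a y : W (a *: y) = a *: W y.
  have W0 : W 0 = 0 by have := lW (-1) 0 0; rewrite scaler0 addr0 scaleN1r addNr.
  by have := lW a y 0; rewrite !addr0 W0 addr0.
have [->|] := eqVneq x 0.
  by have := WZ 0 0; rewrite !scale0r => ->; rewrite rnorm0 mulr0.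
(* Scaling [x] to norm [d / 2], strictly inside the ball, produces the factor [2 / d]. *)
rewrite -rnorm_gt0 => x0; pose c := d / 2 / rnorm x.
have c0 : 0 < c by rewrite !divr_gt0.
have := W1 (c%:C *: x).
rewrite WZ !rnormZR gtr0_norm// divfK ?gt_eqF// => /(_ _)/wrap[]; first lra.
rewrite -ler_pdivlMl// mulr1 /c.
suff -> : (d / 2 / rnorm x)^-1 = 2 / d * rnorm x by [].
by field; rewrite !gt_eqF.
Qed.

(** The nonzero vectors of the kernel form an open set. Its preimage under [g] composed with
    [coker_pi Z] is the complement of the image, which is therefore open. *)
Lemma generalized_index_zero_closed (Z : bop X) : generalized_index_zero Z ->
  forall x, (forall e : R, 0 < e -> exists2 m, range Z m & rnorm (x - m) < e) ->
  range Z x.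
Proof.
move=> [f [g [fK gK _ cg]]] x xZ.
have f0 : f 0 = 0 by exact: linear0.
have oU : open [set k : ker_space Z | k <> 0].
  rewrite ker_openE; exists [set~ 0].
    rewrite openE => y /eqP y0; apply/nbhs_rnormP.
    exists (rnorm y) => [|z yz /= z0]; first by rewrite rnorm_gt0.
    by rewrite z0 subr0 ltxx in yz.
  apply/seteqP; split=> k /= k0 kE; apply: k0; first by rewrite kE.
  exact: val_inj.
have /continuousP/(_ _ oU) := cg.
rewrite -[open _]/(coker_open _) /coker_open => oV.
apply: contrapT => nZx.
have /nbhs_rnormP[e e0 eV] : nbhs x (coker_pi Z @^-1` (g @^-1` [set k | k <> 0])).
  apply: open_nbhs_nbhs; split=> //= gx0; apply: nZx; apply/coker_pi_eq0.
  by rewrite -[LHS]gK gx0 f0.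
have [m Zm xm] := xZ e e0; apply: (eV m xm).
by have /coker_pi_eq0 -> := Zm; rewrite -f0 fK.
Qed.

(** [P] projects orthogonally onto the kernel, and [W x] is the representative of [f (P x)]
    orthogonal to the image. *)
Lemma generalized_index_zero_split (Z : bop X) : generalized_index_zero Z ->
  exists P W : bop X, [/\ forall x, Z (P x) = 0, forall x, Z x = 0 -> P x = x,
    W * P = W & bop_unit (Z + W)].
Proof.
move=> Z0; have ranZ := generalized_index_zero_closed Z0.
have [f [g [fK gK cf cg]]] := Z0.
have [||| P [PK PO]] := @projection _ _ dotp dotp_norm (bop_ker Z).
- exact: linear0.
- by move=> a x y /= Zx Zy; rewrite /bop_ker/= linearP/= Zx Zy scaler0 addr0.
- move=> x xZ; apply/eqP; rewrite -rnorm_eq0 eq_le rnorm_ge0 andbT.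
  apply/ler_addgt0Pr => e e0; rewrite add0r.
  have c0 : 0 < opnorm Z + 1 by have := opnorm_ge0 Z; lra.
  have [m Zm xm] := xZ (e / (opnorm Z + 1)) (divr_gt0 e0 c0).
  rewrite -[Z x]subr0 -[X in _ - X]Zm -linearB (le_trans (opnormP _ _))//.
  rewrite ltr_pdivlMr// mulrC in xm; apply: le_trans (ltW xm).
  by rewrite ler_wpM2r ?rnorm_ge0// lerDl.
have [||| Q [QI QO]] := @projection _ _ dotp dotp_norm (range Z).
- by exists 0 => //; rewrite linear0.
- by move=> a _ _ [x _ <-] [y _ <-]; exists (a *: x + y) => //; rewrite linearP.
- exact: ranZ.
have PE x : Z x = 0 -> P x = x.
  move=> Zx; have MxP : bop_ker Z (x - P x).
    by rewrite /bop_ker/= linearB/= Zx PK subr0.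
  have := PO x _ MxP; rewrite dotpE// => /complexI/eqP.
  by rewrite sqrf_eq0 rnorm_eq0 subr_eq0 => /eqP.
have QE x : range Z x -> Q x = x.
  move=> Zx; have MxQ : range Z (x - Q x).
    by rewrite -[x - _]addrC -scaleN1r; have [y _ <-] := QI x; have [z _ <-] := Zx;
      exists (-1 *: y + z) => //; rewrite linearP.
  have := QO x _ MxQ; rewrite dotpE// => /complexI/eqP.
  by rewrite sqrf_eq0 rnorm_eq0 subr_eq0 => /eqP.
(* The orthogonal representative depends only on the class, so the arbitrary choice [w] below leaves
   [F] well-defined and linear. *)
have Qeq x y : coker_pi Z x = coker_pi Z y -> x - Q x = y - Q y.
  move=> /eqP; rewrite coker_piE => /set_mem/QE; rewrite linearB/= => xy.
  apply/eqP; rewrite -subr_eq0 opprB [Q y - y]addrC addrACA -xy addrACA.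
  by rewrite subrr addNr addr0.
have Kp x : kerp Z (P x) by apply/mem_set; exact: PK.
pose p x : ker_space Z := KerSpace (Kp x).
have pL a x y : p (a *: x + y) = a *: p x + p y by apply: val_inj; rewrite /= linearP.
have /choice[w wP] : forall x, exists w, f (p x) = coker_pi Z w.
  by move=> x; exact: coker_piP.
pose F x := w x - Q (w x).
have FE x u : f (p x) = coker_pi Z u -> F x = u - Q u.
  by rewrite wP; exact: Qeq.
have FL : linear F.
  move=> a x y; rewrite (FE _ (a *: w x + w y)).
    by rewrite linearP/= opprD addrACA -scalerBr.
  by rewrite pL linearP/= !wP coker_pi_linear.
have [d d0 dF] : exists2 d : R, 0 < d & forall x, rnorm x < d -> rnorm (F x) <= 1.
  (* The open unit ball of the cokernel: continuity of [f] at 0 puts [f (p x)] into it, and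
     orthogonal representatives are no longer than any others. *)
  pose V := [set q : coker_space Z | exists2 x, q = coker_pi Z x & rnorm x < 1].
  have oV : open V.
    rewrite -[open _]/(coker_open _) /coker_open openE => y [x yx x1].
    apply/nbhs_rnormP; exists (1 - rnorm x) => [|z yz]; first lra.
    exists (x + (z - y)).
      by rewrite coker_piD -yx -coker_piD addrCA subrr addr0.
    by have := rnormD x (z - y); rewrite (rnorm_distC z); lra.
  have /continuousP/(_ _ oV) := cf.
  rewrite ker_openE => -[C oC CV].
  have /nbhs_rnormP[d d0 dC] : nbhs 0 C.
    apply: open_nbhs_nbhs; split=> //.
    suff : (@ker_val R X Z @^-1` C) 0 by [].
    rewrite CV /= linear0; exists 0; last by rewrite rnorm0.
    by apply/esym/coker_pi_eq0; exists 0 => //; exact: linear0.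
  exists d => // x xd.
  have : V (f (p x)).
    change ((f @^-1` V) (p x)); rewrite -CV; apply: dC.
    rewrite sub0r rnormN (le_lt_trans _ xd)//.
    exact: (pythagoras_le dotp_norm (PO _ _ (PK x))).1.
  case=> u /FE -> /ltW; apply: le_trans.
  exact: (pythagoras_le dotp_norm (QO _ _ (QI u))).2.
have [||W WE] := @bop_ex R X F (2 / d) => //.
  exact: bounded_of_ball.
have WP : W * P = W.
  apply: bop_eqP => x /=; rewrite !WE; apply: FE; rewrite -wP; congr (f _).
  by apply: val_inj => /=; apply: PE; exact: PK.
exists P, W; split.
- exact: PK.
- exact: PE.
- exact: WP.
(* By orthogonality, [Z x + W x = 0] makes both terms vanish; then [x] is in the kernel and [f]
   sends it to 0. *)
have TI x : dotp (W x) (Z x) = 0 by rewrite WE; apply: QO; exists x.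
apply: bounded_inverse.
- suff inj0 x : (Z + W) x = 0 -> x = 0.
    by move=> x y xy; apply/eqP; rewrite -subr_eq0; apply/eqP/inj0;
      rewrite (linearB (Z + W)); apply/eqP; rewrite subr_eq0; apply/eqP.
  rewrite bopD => ZW0.
  have Wx0 : W x = 0.
    apply/eqP; rewrite -rnorm_eq0 -sqrf_eq0.
    rewrite -[_ == 0](inj_eq (@complexI R)) -(dotpE dotp_norm).
    have {2}-> : W x = - Z x by apply/eqP; rewrite -addr_eq0 addrC ZW0.
    by rewrite linearNr/= TI oppr0.
  have Zx0 : Z x = 0 by rewrite -ZW0 Wx0 addr0.
  have : f (p x) = f 0.
    rewrite linear0 wP; apply/coker_pi_eq0.
    move: Wx0; rewrite WE => /eqP; rewrite subr_eq0 => /eqP ->; exact: QI.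
  by move/(can_inj fK)/(congr1 val) => /=; rewrite PE.
- move=> y; have [u _ Zu] := QI y.
  (* In the preimage [u - P u + k], the part [u - P u] yields [Q y] through [Z] and nothing through
     [W], while [k] yields [y - Q y] through [W]. *)
  pose k : X := ker_val (g (coker_pi Z y)).
  have Zk : Z k = 0 by apply/set_mem/(ker_subproof (g (coker_pi Z y))).
  exists (u - P u + k); rewrite bopD !linearD !linearN/= PK Zk Zu !(oppr0, addr0).
  have -> : W (P u) = W u by rewrite -[in RHS]WP.
  rewrite subrr add0r WE (FE _ y) 1?addrC ?subrK//.
  rewrite -[RHS]gK; congr (f _); apply: val_inj => /=; exact: PE.
Qed.
End IndexZero.

(** * Estimates for conjugates by operators near [Z] *)

Section Conjugation.
Context {R : realType} {X : completeNormedModType R[i]}.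

(** Both terms of [Z (A k) = U (A k) - (U - Z) (A k)] carry a factor [U - Z], because
    [U k = (U - Z) k]. *)
Lemma rnorm_conj (Z U A : bop X) (k : X) : bop_unit U -> Z k = 0 ->
  rnorm (Z (A k)) <=
  rnorm (U - Z) * (rnorm (A k) + rnorm (U * A * bop_inv U) * rnorm k).
Proof.
move=> /bop_invP[_ VU] Zk.
have UA : U (A k) = (U * A * bop_inv U) (U k).
  rewrite -[in LHS](_ : (bop_inv U * U) k = k)//; first by rewrite VU.
have UZ x : rnorm ((U - Z) x) <= rnorm (U - Z) * rnorm x by exact: opnormP.
have -> : Z (A k) = U (A k) - (U - Z) (A k) by rewrite opprB addrC subrK.
rewrite (le_trans (rnormB _ _))// addrC mulrDr lerD// UA.
rewrite (le_trans (opnormP _ _))// mulrCA ler_wpM2l ?opnorm_ge0//.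
have {1}-> : U k = (U - Z) k by rewrite -[RHS]/(U k - Z k) Zk subr0.
exact: UZ.
Qed.

(** For idempotent [P]: multiplication by [a] on the image of [P], the identity on its kernel. *)
Definition dilation (P : bop X) (a : R) : bop X := 1 - P + a%:C *: P.

Lemma dilationM (P : bop X) a b : P * P = P ->
  dilation P a * dilation P b = dilation P (a * b).
Proof.
move=> PP; apply: bop_eqP => x.
have P_ y : P (P y) = P y by rewrite -[in RHS]PP.
have E c y : dilation P c y = y - P y + c%:C *: P y by [].
rewrite -[LHS]/(dilation P a (dilation P b x)) !E.
rewrite (linearD P) (linearB P)/= linearZ/= !P_ subrr add0r.
by rewrite addrK scalerA rmorphM.
Qed.

Lemma dilation1 (P : bop X) : dilation P 1 = 1.
Proof. by rewrite /dilation rmorph1 scale1r subrK. Qed.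

(** Conjugation scales the block [P * A * (1 - P)] by [a] and [(1 - P) * A * P] by [a^-1];
    invariance kills the latter. *)
Lemma dilation_conj (P A : bop X) a : a != 0 -> P * P = P -> P * (A * P) = A * P ->
  dilation P a * A * dilation P a^-1 =
  (1 - P) * A * (1 - P) + A * P + a%:C *: (P * A * (1 - P)).
Proof.
move=> a0 PP PAP; apply: bop_eqP => x.
have PAP_ y : P (A (P y)) = A (P y) by exact: (congr1 (fun B : bop X => B y) PAP).
have E c y : dilation P c y = y - P y + c%:C *: P y by [].
rewrite -[LHS]/(dilation P a (A (dilation P a^-1 x))) !E.
rewrite -[RHS]/((A (x - P x) - P (A (x - P x))) + A (P x) + a%:C *: P (A (x - P x))).
set u := x - P x; rewrite (linearD A) (linearD P)/= !linearZ/= PAP_.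
rewrite opprD addrACA subrr addr0 scalerDr scalerA -rmorphM mulfV//.
by rewrite scale1r [RHS]addrAC addrA.
Qed.

Lemma bop_unit_mul (U V : bop X) : bop_unit U -> bop_unit V -> bop_unit (U * V).
Proof.
move=> [U' [UU' U'U]] [V' [VV' V'V]]; exists (V' * U'); split.
  by rewrite mulrA -[U * V * V']mulrA VV' mulr1.
by rewrite mulrA -[V' * U' * U]mulrA U'U mulr1.
Qed.

Lemma dilation_unit (P : bop X) a : a != 0 -> P * P = P ->
  bop_inverses (dilation P a) (dilation P a^-1).
Proof.
by move=> a0 PP; split; rewrite dilationM// ?mulfV ?mulVf// dilation1.
Qed.

Section Approximation.
Variables (Z P W : bop X).
Hypothesis ZP : Z * P = 0.
Hypothesis PP : P * P = P.
Hypothesis WP : W * P = W.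
Hypothesis ZWu : bop_unit (Z + W).

(** [Z] vanishes on the image of [P] and [W] on its kernel. *)
Lemma approximantE a : (Z + W) * dilation P a = Z + a%:C *: W.
Proof.
apply: bop_eqP => x.
have ZP_ y : Z (P y) = 0 by rewrite -[LHS]/((Z * P) y) ZP.
have WP_ y : W (P y) = W y by rewrite -[in RHS]WP.
rewrite -[LHS]/((Z + W) (x - P x + a%:C *: P x)) -[RHS]/(Z x + a%:C *: W x).
by rewrite bopD !linearD !linearN !linearZ/= !ZP_ !WP_ scaler0 oppr0 !addr0 subrr add0r.
Qed.

Lemma approximant_unit a : a != 0 -> bop_unit (Z + a%:C *: W).
Proof.
move=> a0; rewrite -approximantE; apply: bop_unit_mul => //.
by exists (dilation P a^-1); exact: dilation_unit.
Qed.

Lemma approximant_dist a : rnorm (Z + a%:C *: W - Z) = `|a| * rnorm W.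
Proof. by rewrite addrAC subrr add0r rnormZR. Qed.

Lemma approximant_conj_bounded (A : bop X) : P * (A * P) = A * P ->
  exists M : R, forall a, 0 < a <= 1 ->
    let U := Z + a%:C *: W in rnorm (U * A * bop_inv U) <= M.
Proof.
move=> PAP; have [S [TS ST]] := ZWu; set T := Z + W in TS ST.
(* The first norm is the part independent of [a]; the second bounds the part with factor
   [a <= 1]. *)
exists (rnorm (T * ((1 - P) * A * (1 - P) + A * P) * S) +
        rnorm (T * (P * A * (1 - P)) * S)) => a /andP[a0 a1] /=.
have an0 : a != 0 by rewrite gt_eqF.
have [DD' D'D] := dilation_unit an0 PP.
rewrite -approximantE -/T (@bop_invE _ _ _ (dilation P a^-1 * S)).
- have -> : T * dilation P a * A * (dilation P a^-1 * S) =
    T * (dilation P a * A * dilation P a^-1) * S by rewrite !mulrA.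
  rewrite dilation_conj// mulrDr mulrDl.
  have -> : T * (a%:C *: (P * A * (1 - P))) * S = a%:C *: (T * (P * A * (1 - P)) * S).
    by apply: bop_eqP => x; exact: (linearZ_LR T).
  rewrite (le_trans (rnormD _ _))// lerD// rnormZR gtr0_norm//.
  by rewrite ler_piMl ?rnorm_ge0.
- by rewrite mulrA -[T * _ * _]mulrA DD' mulr1.
- by rewrite mulrA -[_ * S * T]mulrA ST mulr1.
Qed.

End Approximation.
End Conjugation.

(** * Real hyperplanes are Lebesgue null sets *)

Section Hyperplanes.
Context {R : realType}.

(** The recursion follows that of [lebesgue_space], so that measurability and slicing go by
    induction on [d]. *)
Fixpoint linear_form d (a : nat -> R) : sf_type (lebesgue_space R d) -> R :=
  match d with
  | 0 => fun=> 0
  | d'.+1 => fun c => a 0 * c.1 + @linear_form d' (a \o S) c.2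
  end.

Lemma linear_formE d a (c : sf_type (lebesgue_space R d)) :
  linear_form a c = \sum_(i < d) a i * (coords c)`_i.
Proof.
elim: d a c => [|d IH] a c /=; first by rewrite big_ord0.
by rewrite big_ord_recl IH.
Qed.

Lemma measurable_linear_form d a :
  measurable_fun [set: sf_type (lebesgue_space R d)] (@linear_form d a).
Proof.
elim: d a => [|d IH] a /=; first exact: measurable_cst.
apply: measurable_funD.
  apply: measurable_funM; first exact: measurable_cst.
  exact: measurable_fst.
by apply: measurableT_comp => //; exact: measurable_snd.
Qed.

Lemma measurable_hyperplane d a t :
  measurable [set c : sf_type (lebesgue_space R d) | linear_form a c = t].
Proof.
rewrite -[X in measurable X]setTI.
exact: (measurable_linear_form a measurableT (measurable_set1 t)).
Qed.

(** Slice along the first coordinate. If a later coefficient is nonzero, each slice is a null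
    hyperplane; otherwise the set is a point times the whole space. *)
Lemma hyperplane_null d (a : nat -> R) t : (exists2 i, (i < d)%N & a i != 0) ->
  sf_measure (lebesgue_space R d) [set c | linear_form a c = t] = 0%E.
Proof.
elim: d a t => [|d IH] a t [i // id ai] /=.
have [[j jd aj]|na] := pselect (exists2 j, (j < d)%N & (a \o S) j != 0).
  rewrite /lebesgue_prod /product_measure1 /=.
  rewrite integral0_eq// => x _ /=.
  rewrite [X in sf_measure _ X](_ : _ = [set c | linear_form (a \o S) c = t - a 0 * x]).
    by apply: IH; exists j.
  rewrite /xsection; apply/seteqP; split => c /=; rewrite ?inE/=.
    by move=> <-; rewrite [a 0 * x + _]addrC addrK.
  by move=> ->; rewrite addrC subrK.
have a0 : a 0 != 0.
  by case: i id ai => // i id ai; case: na; exists i.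
have aS (c : sf_type (lebesgue_space R d)) : linear_form (a \o S) c = 0.
  rewrite linear_formE big1// => j _; apply/eqP; rewrite mulf_eq0; apply/orP; left.
  by apply: contraT => aj; case: na; exists j.
rewrite [X in lebesgue_prod _ X](_ : _ = [set t / a 0] `*` setT).
  (* The second factor may have infinite measure; 0 times [+oo] is 0 in [\bar R]. *)
  rewrite /lebesgue_prod product_measure1E// [X in (X * _)%E]lebesgue_measure_set1.
  by rewrite mul0e.
apply/seteqP; split => -[x c] /=; rewrite aS addr0.
  by move=> <-; split=> //; rewrite mulrAC mulfV// mul1r.
by move=> [-> _]; rewrite mulrC divfK.
Qed.

End Hyperplanes.

(** * Bounded conjugates force invariance of the kernel *)

Section Blowup.
Context {R : realType} {X : completeNormedModType R[i]}.
Implicit Types A U Z : bop X.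

Lemma le0_of_small (v C e : R) : 0 < e -> 0 <= C ->
  (forall r, 0 < r < e -> v <= r * C) -> v <= 0.
Proof.
move=> e0 C0 vC; rewrite leNgt; apply/negP => v0.
have C1 : 0 < C + 1 by lra.
(* At [r = s], and at [e / 2] if that is smaller, [r * C] is at most [v / 2]. *)
pose s := v / 2 / (C + 1).
have s0 : 0 < s by rewrite !divr_gt0.
have sC : s * (C + 1) = v / 2 by rewrite divfK// gt_eqF.
have [se|es] := leP s (e / 2).
  have /vC vs : 0 < s < e by rewrite s0 (le_lt_trans se)//; lra.
  by nra.
have /vC ve : 0 < e / 2 < e by apply/andP; split; lra.
have := ler_wpM2r C0 (ltW es); nra.
Qed.

(** A finite limit superior gives one [M] and, at every small radius [r], an invertible [U] with
    conjugate below [M]; [rnorm_conj] then bounds [Z (A k)] by a multiple of [r]. *)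
Lemma Scup_sub_invariant Z A (k : X) : Scup Z A -> Z k = 0 -> Z (A k) = 0.
Proof.
move=> /ereal_inf_lt[_ [V V0 <-]] supV Zk.
have [M M0 supM] : exists2 M : R, 0 <= M & (ereal_sup
    ((fun r : R => ereal_inf [set (rnorm (U * A * bop_inv U))%:E
      | U in [set U | bop_unit U /\ (rnorm (U - Z) < r)%R]]) @` V) < M%:E)%E.
  move: supV; case: ereal_sup => [s _|//|_].
  - by exists (`|s| + 1); rewrite ?addr_ge0// lte_fin ltr_pwDr// ler_norm.
  - by exists 0 => //; rewrite ltNyr.
have [e /= e0 eV] := V0.
apply/eqP; rewrite -rnorm_eq0 eq_le rnorm_ge0 andbT.
apply: (@le0_of_small _ (rnorm (A k) + M * rnorm k) e) => //.
  by rewrite addr_ge0 ?mulr_ge0 ?rnorm_ge0.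
move=> r /andP[r0 re].
have Vr : V r by apply: eV => //=; rewrite sub0r normrN gtr0_norm.
have /ereal_inf_lt[_ [U [uU Ur] <-]] :
    (ereal_inf [set (rnorm (U * A * bop_inv U))%:E
      | U in [set U | bop_unit U /\ (rnorm (U - Z) < r)%R]] < M%:E)%E.
  by apply: le_lt_trans supM; apply: ereal_sup_ubound; exists r.
rewrite lte_fin => UM.
rewrite (le_trans (rnorm_conj A uU Zk))// ler_pM ?rnorm_ge0 ?(ltW Ur)//.
  by rewrite addr_ge0 ?mulr_ge0 ?rnorm_ge0.
by rewrite lerD2l ler_wpM2r ?rnorm_ge0// ltW.
Qed.

Lemma conj_blowup Z A (k : X) (U : nat -> bop X) :
  (forall n, bop_unit (U n)) -> U @ \oo --> Z -> Z k = 0 -> Z (A k) <> 0 ->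
  rnorm (U n * A * bop_inv (U n)) @[n --> \oo] --> +oo.
Proof.
move=> uU /cvg_rnormP UZ Zk /eqP; rewrite -rnorm_gt0 => ZAk.
apply/cvgryPge => M.
(* The summand 1 keeps the divisor positive, and the absolute value handles negative [M]. *)
pose C := rnorm (A k) + `|M| * rnorm k + 1.
have C0 : 0 < C by rewrite ltr_wpDl// addr_ge0 ?mulr_ge0 ?rnorm_ge0.
near=> n; rewrite leNgt; apply/negP => UM.
have Un : rnorm (Z - U n) < rnorm (Z (A k)) / C.
  by near: n; apply: UZ; rewrite divr_gt0.
have := rnorm_conj A (uU n) Zk; apply/negP; rewrite -ltNge.
rewrite rnorm_distC ltr_pdivlMr// in Un; apply: le_lt_trans Un.
rewrite rnorm_distC ler_wpM2l ?rnorm_ge0// /C -addrA lerD2l.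
rewrite ler_wpDr// ler_wpM2r ?rnorm_ge0// (le_trans (ltW UM))//.
exact: ler_norm.
Unshelve. all: by end_near. Qed.

End Blowup.

(** * Almost every operator moves a given kernel vector out of the kernel *)

Section Exceptional.
Context {R : realType} {X : completeNormedModType R[i]}.
Variable dotp : {dot X for @Num.conj R[i]}.
Hypothesis dotp_norm : forall x : X, `|x| ^+ 2 = dotp x x.

Lemma RenormM (a b : R[i]) :
  complex.Re `|a * b| = complex.Re `|a| * complex.Re `|b|.
Proof. by apply: (@complexI R); rewrite rmorphM !RenormE normrM. Qed.

(** A rank-one operator, bounded by Cauchy-Schwarz. *)
Lemma transitive_on_nonzero (x y : X) : x != 0 -> exists A : bop X, A x = y.
Proof.
move=> x0; have xx0 : dotp x x != 0 by rewrite gt_eqF// neq0_dnorm_gt0.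
have [||A AE] := @bop_ex R X (fun z => (dotp z x / dotp x x) *: y)
   (rnorm x * complex.Re `|(dotp x x)^-1| * rnorm y).
- move=> a u v; rewrite linearDl/= linearZl_LR/= scalerA -scalerDl.
  by congr (_ *: _); rewrite mulrDl mulrA.
- move=> z; rewrite rnormZ RenormM -[leLHS]mulrA.
  rewrite -[_ * _ * rnorm y]mulrA [leRHS]mulrAC [rnorm x * _]mulrC.
  by rewrite ler_wpM2r ?mulr_ge0 ?Renorm_ge0 ?rnorm_ge0//; exact: cauchy_schwarz.
by exists A; rewrite AE mulfV// scale1r.
Qed.

Lemma Re_realM (c : R) (z : R[i]) : complex.Re (c%:C * z) = c * complex.Re z.
Proof. by case: z => a b /=; rewrite mul0r subr0. Qed.

Lemma Re_sum (I : finType) (F : I -> R[i]) :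
  complex.Re (\sum_i F i) = \sum_i complex.Re (F i).
Proof. by apply: (big_morph (@complex.Re R)) => // -[a b] [c e]. Qed.

Lemma bop_sumE (I : finType) (F : I -> bop X) x : (\sum_i F i) x = \sum_i F i x.
Proof. exact: (big_morph (fun A : bop X => A x)). Qed.

(** Some basis operator [b j] has [v = Z (b j k)] nonzero. The real part of [dotp (Z (A k)) v] is a
    real linear form in [A], with coefficient [rnorm v ^+ 2] at [b j], so its kernel is null. *)
Lemma invariant_null (Z : bop X) (k : X) : k != 0 -> Z k = 0 -> Z <> 0 ->
  lebesgue_ae [set A : bop X | Z (A k) <> 0].
Proof.
move=> k0 Zk Zn0 d b bb.
have [y Zy] : exists y, Z y != 0.
  apply: contrapT => ny; apply: Zn0; apply: bop_eqP => y; apply/eqP.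
  by apply: contraT => Zy; case: ny; exists y.
have [A Ak] := transitive_on_nonzero y k0.
have [j vj] : exists j, Z (b j k) != 0.
  apply: contrapT => nj; move: Zy; rewrite -Ak.
  have [c [-> _]] := bb A.
  rewrite bop_sumE linear_sum big1 ?eqxx// => i _; rewrite bopZ linearZ/=.
  have [->|Zb] := eqVneq (Z (b i k)) 0; first by rewrite scaler0.
  by case: nj; exists i.
set v := Z (b j k) in vj.
pose al (i : 'I_d) := complex.Re (dotp (Z (b i k)) v).
(* Extension by 0 beyond [d], as [linear_form] takes its coefficients from a sequence. *)
pose a n := oapp al 0 (insub n).
have aE (i : 'I_d) : a i = al i by rewrite /a valK.
have ZE (c : 'I_d -> R) :
    complex.Re (dotp (Z ((\sum_i (c i)%:C *: b i : bop X) k)) v) = \sum_i al i * c i.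
  rewrite bop_sumE linear_sum linear_sumlz Re_sum; apply: eq_bigr => i _.
  by rewrite bopZ linearZ/= linearZl_LR/= Re_realM mulrC.
exists [set c | linear_form a c = 0]; split.
- exact: measurable_hyperplane.
- apply: hyperplane_null; exists j => //.
  rewrite aE /al dotpE//= sqrf_eq0.
  by rewrite rnorm_eq0.
- move=> c /= /contrapT Zc; rewrite linear_formE.
  under eq_bigr do rewrite aE.
  by rewrite -ZE Zc linear0l.
Qed.

End Exceptional.

Lemma invariant_sub_Scup (R : realType) (X : completeNormedModType R[i])
    (Z P W A : bop X) :
  Z * P = 0 -> P * P = P -> W * P = W -> bop_unit (Z + W) ->
  P * (A * P) = A * P -> Scup Z A.
Proof.
move=> ZP PP WP uT PAP.
have [M UM] := approximant_conj_bounded ZP PP WP uT PAP.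
apply: (@le_lt_trans _ _ M%:E); last exact: ltry.
apply: le_trans (_ : (ereal_sup _ <= _)%E).
  (* The bound holds for all [r > 0], so this one neighbourhood suffices. *)
  by apply: ereal_inf_lbound; exists [set r | 0 < r] => //; exact: nbhs_right_gt.
apply: ge_ereal_sup => _ [r /= r0 <-].
have W1 : 0 < rnorm W + 1 by rewrite ltr_wpDl ?rnorm_ge0.
(* [a <= 1] serves the uniform bound; the summand 1 makes the distance [a * rnorm W] strictly less
   than [r], also when [W] is 0. *)
pose a := Num.min 1 (r / (rnorm W + 1)).
have a0 : 0 < a by rewrite lt_min ltr01 divr_gt0.
apply: le_trans (_ : ((rnorm ((Z + a%:C *: W) * A * bop_inv (Z + a%:C *: W)))%:E <= _)%E).
  apply: ereal_inf_lbound; exists (Z + a%:C *: W) => //; split.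
    exact: (approximant_unit ZP PP WP uT (lt0r_neq0 a0)).
  rewrite approximant_dist gtr0_norm// (@lt_le_trans _ _ (a * (rnorm W + 1)))//.
    by rewrite ltr_pM2l// ltrDl.
  by rewrite -ler_pdivlMr// ge_min lexx orbT.
by rewrite lee_fin; apply: UM; rewrite a0 ge_min lexx.
Qed.

Theorem theorem1p9 (R : realType) (X : completeNormedModType R[i])
    (dotp : {dot X for @Num.conj R[i]})
    (dotp_norm : forall x : X, `|x| ^+ 2 = dotp x x)
    (Z : bop X) (Z0 : generalized_index_zero Z) :
  [/\ exists U : nat -> bop X,
        (forall n, bop_unit (U n)) /\ U @ \oo --> Z,
      Scup Z = [set A : bop X | A @` bop_ker Z `<=` bop_ker Z]
    & finite_dimensional X -> ~ bop_unit Z -> Z <> 0 ->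
      forall U : nat -> bop X,
        (forall n, bop_unit (U n)) -> U @ \oo --> Z ->
        lebesgue_ae [set A : bop X |
          rnorm (U n * A * bop_inv (U n)) @[n --> \oo] --> +oo]].
Proof.
have [P [W [PK PE WP uT]]] := generalized_index_zero_split dotp_norm Z0.
have ZP : Z * P = 0 by apply: bop_eqP => x; exact: PK.
have PP : P * P = P by apply: bop_eqP => x; exact/PE/PK.
split.
- exists (fun n => Z + (n.+1%:R^-1 : R)%:C *: W); split=> [n|].
    by apply: (approximant_unit ZP).
  apply/cvg_rnormP => e e0.
  have W1 : 0 < rnorm W + 1 by rewrite ltr_wpDl ?rnorm_ge0.
  near=> n; rewrite rnorm_distC approximant_dist gtr0_norm//.
  have : n.+1%:R^-1 < e / (rnorm W + 1).
    near: n; exact: (near_infty_natSinv_lt (PosNum (divr_gt0 e0 W1))).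
  rewrite ltr_pdivlMr//; apply: le_lt_trans.
  by rewrite ler_pM2l// lerDl.
- apply/seteqP; split=> A.
    by move=> AS _ [k Zk <-]; exact: Scup_sub_invariant AS Zk.
  move=> AK; apply: (invariant_sub_Scup ZP PP WP uT).
  by apply: bop_eqP => x; apply: PE; apply: AK; exists (P x) => //; exact: PK.
- move=> _ nuZ Zn0 U uU UZ d b bb.
  (* With trivial kernel, [P = 0], hence [W = W * P = 0] and [Z = Z + W] would be invertible. *)
  have [k [k0 Zk]] : exists k, k != 0 /\ Z k = 0.
    apply: contrapT => nk; apply: nuZ.
    have P0 : P = 0.
      apply: bop_eqP => x; apply/eqP; apply: contraT => Px.
      by case: nk; exists (P x); split=> //; exact: PK.
    by move: uT; rewrite -WP P0 mulr0 addr0.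
  have := invariant_null dotp_norm k0 Zk Zn0 bb.
  by apply: filterS => c; exact: conj_blowup.
Unshelve. all: by end_near. Qed.
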